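(* With $A$, $S=F[\{z_{N,\mu}:(N,\mu)\in A\}]$, the term order $\prec$ and the set of binomials $G_1\subseteq S$ as in the context, $$|A+A|=\dim_F\big(S/\langle\mathrm{in}_\prec(G_1)\rangle\big)_2 .$$
   Context: Let $p$ be a prime, $q\ge1$, $1\le\ell\le p-1$ integers and $F$ a field (in the paper, the base field of either fibre of the family). $A=\{(N,\mu)\in\mathbb{N}^2:\lfloor\mu\ell/p\rfloor\le N\le\mu q-2,\ 1\le\mu\le p-1\}$ and $A+A=\{(N+N',\mu+\mu'):(N,\mu),(N',\mu')\in A\}$ is the Minkowski sum. Multidegree: $\mathrm{mdeg}(z_{N_1,\mu_1}\cdots z_{N_d,\mu_d})=(d,\sum N_i,\sum\mu_i)$. $G_1$ is the set of all binomials $z_{N_1,\mu_1}z_{N'_1,\mu'_1}-z_{N_2,\mu_2}z_{N'_2,\mu'_2}\in S$ with both monomials of degree $2$ and of the same multidegree. Term order: let $\prec_t$ be the lexicographic order on the variables $z_{N,\mu}$. Define $z_{N_1,\mu_1}\cdots z_{N_d,\mu_d}\prec z_{N'_1,\mu'_1}\cdots z_{N'_s,\mu'_s}$ iff (i) $d<s$; or (ii) $d=s$ and $\sum\mu_i>\sum\mu'_i$; or (iii) $d=s$, $\sum\mu_i=\sum\mu'_i$ and $\sum N_i<\sum N'_i$; or (iv) $d=s$, $\sum\mu_i=\sum\mu'_i$, $\sum N_i=\sum N'_i$ and $z_{N_1,\mu_1}\cdots z_{N_d,\mu_d}\prec_t z_{N'_1,\mu'_1}\cdots z_{N'_s,\mu'_s}$.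 $\mathrm{in}_\prec(f)$ is the leading term of a nonzero $f$, $\mathrm{in}_\prec(G_1)=\{\mathrm{in}_\prec(f):0\ne f\in G_1\}$; the subscript $2$ denotes the degree $2$ piece for the standard grading. *)

(* Defs.v *)
From HB Require Import structures.
From mathcomp Require Import all_boot all_order all_algebra finmap boolp.
From mathcomp.multinomials Require Import mpoly.

Set Implicit Arguments.
Unset Strict Implicit.
Unset Printing Implicit Defensive.

Import GRing.Theory.

Local Open Scope quotient_scope.
Local Open Scope ring_scope.

Section Dimension.
Variables (F : fieldType) (V : lmodType F).
Implicit Types (U : V -> Prop) (d e : nat).

(* [d] is the dimension over [F] of the subspace [U] of [V], where [V] itself
   need not be finite dimensional: [U] has a basis with [d] elements. *)
Definition has_dim U d : Prop :=
  exists b : 'I_d -> V,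
    [/\ forall i, U (b i),
        forall v, U v -> exists c : 'I_d -> F, v = \sum_i c i *: b i
      & forall c : 'I_d -> F, \sum_i c i *: b i = 0 -> forall i, c i = 0].

Lemma has_dim_le U d e : has_dim U d -> has_dim U e -> (e <= d)%N.
Proof.
move=> [b [_ span_b _]] [b' [Ub' _ free_b']]; rewrite leqNgt; apply/negP => lt_de.
pose C j := projT1 (cid (span_b _ (Ub' j))).
have CE j : b' j = \sum_i C j i *: b i by rewrite /C; case: cid.
pose P : 'M[F]_(e, d) := \matrix_(j, i) C j i.
have : kermx P != 0.
  by rewrite -mxrank_eq0 mxrank_ker subn_eq0 -ltnNge (leq_ltn_trans (rank_leq_col P)).
case/rowV0Pn => v /sub_kermxP vP0 /eqP[]; apply/rowP => j; rewrite mxE.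
apply: (free_b' (fun j => v 0 j)).
under eq_bigr => k _ do rewrite CE scaler_sumr.
rewrite exchange_big big1 // => i _.
under eq_bigr => k _ do rewrite scalerA.
rewrite -scaler_suml.
have -> : \sum_k v 0 k * C k i = (v *m P) 0 i.
  by rewrite mxE; apply: eq_bigr => k _; rewrite mxE.
by rewrite vP0 mxE scale0r.
Qed.

Lemma has_dim_unique U d e : has_dim U d -> has_dim U e -> d = e.
Proof. by move=> Ud Ue; apply/eqP; rewrite eqn_leq !(has_dim_le Ud, has_dim_le Ue). Qed.

End Dimension.

Section IdealQuotient.
Variables (F : fieldType) (R : comAlgType F) (G : R -> Prop).

Definition ideal_gen : {pred R} := fun x =>
  `[< exists s : seq (R * R), (forall ag, ag \in s -> G ag.2) /\
        x = \sum_(ag <- s) ag.1 * ag.2 >].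

Lemma ideal_genM a x : x \in ideal_gen -> a * x \in ideal_gen.
Proof.
move=> /asboolP[s [Gs ->]]; apply/asboolP.
exists [seq (a * u.1, u.2) | u <- s]; split=> [_ /mapP[u us ->]|]; first exact: Gs us.
by rewrite big_map mulr_sumr; apply: eq_bigr => u _; rewrite mulrA.
Qed.

Lemma ideal_gen_zmod : zmod_closed ideal_gen.
Proof.
split=> [|x y Ix /(ideal_genM (-1))]; first by apply/asboolP; exists [::]; split; rewrite ?big_nil.
rewrite mulN1r; move: Ix => /asboolP[s [Gs ->]] /asboolP[s' [Gs' ->]].
apply/asboolP; exists (s ++ s'); rewrite big_cat; split=> // u.
by rewrite mem_cat => /orP[/Gs|/Gs'].
Qed.

HB.instance Definition _ := GRing.isZmodClosed.Build R ideal_gen ideal_gen_zmod.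

(* [R / <G>] as an [F]-module. The library's ring structure on quotients
   requires a proper ideal and carries no scalar action. *)
Definition quot_ideal := {ideal_quot ideal_gen}.

HB.instance Definition _ := GRing.Zmodule.on quot_ideal.

Definition quot_pi (x : R) : quot_ideal := \pi_({ideal_quot ideal_gen}) x.

Lemma quot_piE x y : quot_pi x = quot_pi y <-> x - y \in ideal_gen.
Proof. by rewrite Quotient.idealrBE; split=> [/eqP|/eqP]. Qed.

Lemma quot_piD x y : quot_pi (x + y) = quot_pi x + quot_pi y.
Proof. by rewrite /quot_pi raddfD. Qed.

Definition quot_scale (c : F) (x : quot_ideal) : quot_ideal :=
  quot_pi (c *: repr x).

Lemma quot_piZ c x : quot_scale c (quot_pi x) = quot_pi (c *: x).
Proof.
apply/quot_piE; rewrite -scalerBr -mulr_algl; apply: ideal_genM.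
by apply/quot_piE; rewrite /quot_pi reprK.
Qed.

Lemma quot_piP (x : quot_ideal) : exists y, x = quot_pi y.
Proof. by exists (repr x); rewrite /quot_pi reprK. Qed.

Lemma quot_scaleA a b x :
  quot_scale a (quot_scale b x) = quot_scale (a * b) x.
Proof. by have [y ->] := quot_piP x; rewrite !quot_piZ scalerA. Qed.

Lemma quot_scale1 : left_id 1 quot_scale.
Proof. by move=> x; have [y ->] := quot_piP x; rewrite quot_piZ scale1r. Qed.

Lemma quot_scaleDr : right_distributive quot_scale +%R.
Proof.
move=> c x x'; have [[y ->] [y' ->]] := (quot_piP x, quot_piP x').
by rewrite -quot_piD !quot_piZ -quot_piD scalerDr.
Qed.

Lemma quot_scaleDl x : {morph quot_scale^~ x : a b / a + b}.
Proof.
by move=> a b; have [y ->] := quot_piP x; rewrite !quot_piZ -quot_piD scalerDl.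
Qed.

HB.instance Definition _ := GRing.Zmodule_isLmodule.Build F quot_ideal
  quot_scaleA quot_scale1 quot_scaleDr quot_scaleDl.

End IdealQuotient.

Definition quot_graded_piece (F : fieldType) (n : nat) (G : {mpoly F[n]} -> Prop)
    (d : nat) : quot_ideal G -> Prop :=
  fun x => exists2 f : {mpoly F[n]}, f \is d.-homog & x = quot_pi G f.
Arguments quot_graded_piece {F n} G d _.

Section IndexSet.
Variables p q l : nat.

(* The upper bound [N <= mu * q - 2] is between integers: it is written
   [N + 2 <= mu * q] because [mu * q - 2] would truncate to 0. *)
Definition in_A : pred (nat * nat) := fun x =>
  [&& x.2 * l %/ p <= x.1, x.1 + 2 <= x.2 * q, 1 <= x.2 & x.2 <= p - 1]%N.

Definition A : {fset nat * nat} :=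
  [fset x in [seq (N, mu) | N <- iota 0 (p * q), mu <- iota 0 p] | in_A x]%fset.

Lemma mem_A x : (x \in A) = in_A x.
Proof.
rewrite !inE /= andb_idl // => /and4P[_ leN mu_gt0 le_mu].
have lt_mu : (x.2 < p)%N.
  have : (0 < p - 1)%N := leq_trans mu_gt0 le_mu.
  rewrite subn_gt0 => p_gt1; apply: leq_ltn_trans le_mu _.
  by rewrite subn1 ltn_predL ltnW.
case: x => N mu /= in leN lt_mu mu_gt0 le_mu *.
apply/allpairsP; exists (N, mu); rewrite !mem_iota /= !add0n lt_mu; split=> //.
rewrite (leq_trans _ (leq_mul (ltnW lt_mu) (leqnn q))) // (leq_trans _ leN) //.
by rewrite addn2 ltnS leqnSn.
Qed.

Definition minkowski (X Y : {fset nat * nat}) : {fset nat * nat} :=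
  [fset (x.1 + y.1, x.2 + y.2)%N | x in X, y in Y]%fset.

(* The variables are numbered by ['I_nvars]: the [i]-th one is [z_(pt i)], where
   [pt] enumerates [A] without repetition. *)
Definition nvars : nat := #|` A|.
Definition pt (i : 'I_nvars) : nat * nat := nth (0, 0)%N A i.

Definition sumN (m : 'X_{1..nvars}) : nat := (\sum_i m i * (pt i).1)%N.
Definition summu (m : 'X_{1..nvars}) : nat := (\sum_i m i * (pt i).2)%N.
Definition multideg (m : 'X_{1..nvars}) : nat * nat * nat :=
  (mdeg m, sumN m, summu m).

Section TermOrder.
(* [le_var i j] reads [z_i <= z_j]; it is meant to be a total order. [lex_lt]
   compares exponents at the [le_var]-largest variable where they differ. *)
Variable le_var : rel 'I_nvars.

Definition lex_lt (m m' : 'X_{1..nvars}) : bool :=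
  [exists v, (m v < m' v)%N &&
     [forall w, (le_var v w && (w != v)) ==> (m w == m' w)]].

Definition mon_lt (m m' : 'X_{1..nvars}) : bool :=
  [|| (mdeg m < mdeg m')%N,
      (mdeg m == mdeg m') && (summu m > summu m')%N,
      [&& mdeg m == mdeg m', summu m == summu m' & (sumN m < sumN m')%N]
    | [&& mdeg m == mdeg m', summu m == summu m', sumN m == sumN m'
        & lex_lt m m']].

Variable F : fieldType.

Definition is_lead_term (f t : {mpoly F[nvars]}) : Prop :=
  exists m, [/\ m \in msupp f,
    forall m', m' \in msupp f -> m' != m -> mon_lt m' m
    & t = f@_m *: 'X_[m]].

Definition G1 (f : {mpoly F[nvars]}) : Prop :=
  exists m m' : 'X_{1..nvars},
    [/\ mdeg m = 2%N, mdeg m' = 2%N, multideg m = multideg m'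
      & f = 'X_[m] - 'X_[m']].

Definition in_G1 (t : {mpoly F[nvars]}) : Prop :=
  exists f, [/\ G1 f, f != 0 & is_lead_term f t].

End TermOrder.
End IndexSet.

(* Main.v *)
Require Import Defs.
From mathcomp Require Import boolp all_boot all_order all_algebra finmap.
From mathcomp.multinomials Require Import mpoly.

(** The quotient by a monomial ideal has as basis the monomials outside the
    ideal.  As [in_G1] consists of scalar multiples of monomials of degree 2,
    a degree 2 monomial lies in the ideal if and only if it is, up to a scalar,
    itself a leading term ([mcoeff_ideal_gen_eq0]); so the degree 2 piece has as basis
    the monomials [m] of degree 2 that are not leading terms
    ([has_dim_quot_monomials]).

    Two monomials of the same multidegree are compared by [lex_lt] alone, which
    is a strict total order as [le_var] is a total order.  Hence [m] leads some
    binomial of [G1] exactly when it is not the [lex_lt]-least monomial of its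
    multidegree: the other term of the binomial is smaller, and conversely
    ['X_[m] - 'X_[m']] has leading term ['X_[m]] when [m'] is the least
    ([in_G1_inv], [in_G1X]).  So there is exactly one basis monomial for each
    multidegree of degree 2 monomials.  A degree 2 monomial is a product
    [z_i * z_j], so these multidegrees are the triples [(2, N, mu)] with
    [(N, mu)] in [A + A] ([mem_minkowski_A], [minkowski_A_exists]). *)

Import GRing.Theory.

(** * Minimal elements of finite relations *)

Section MinimalElement.
Set Implicit Arguments.
Unset Strict Implicit.

(** A minimal element is found by minimizing the number of predecessors. *)
Lemma exists_minimal (T : finType) (r : rel T) (P : pred T) (x0 : T) :
  irreflexive r -> transitive r -> P x0 ->
  exists2 x, P x & forall y, P y -> ~~ r y x.
Proof.
move=> r_irr r_trans Px0.
case: (arg_minnP (fun x => #|[pred y | r y x]|) Px0) => x Px min_x.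
exists x => // y Py; apply/negP => r_yx.
have := min_x y Py; rewrite leqNgt => /negP[]; apply: proper_card.
apply/properP; split; first by apply/subsetP => z /=; rewrite !inE => /r_trans; apply.
by exists y; rewrite !inE // r_irr.
Qed.

End MinimalElement.

(** * Quotients by monomial ideals *)

Section MonomialIdeal.
Set Implicit Arguments.
Unset Strict Implicit.
Local Open Scope ring_scope.
Variables (F : fieldType) (n : nat) (G : {mpoly F[n]} -> Prop).

(** A multiple of ['X_[m']] involves, in the degree of [m'], no monomial other
    than [m']. *)
Lemma mcoeff_ideal_gen_eq0 (m : 'X_{1..n}) :
  (forall t, G t -> exists c m',
     [/\ t = c *: 'X_[m'], mdeg m' = mdeg m & m' != m]) ->
  forall g, g \in ideal_gen G -> g@_m = 0.
Proof.
move=> GE g /asboolP[s [Gs ->]]; rewrite raddf_sum /= big_seq big1 // => ag /Gs.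
move=> /GE[c [m' [-> deg_m' neq_m']]].
rewrite mcoeffM big1 // => k /eqP mE; rewrite mcoeffZ mcoeffX.
case: eqP => [m'E|_]; last by rewrite !mulr0.
have : mdeg m = (mdeg k.1 + mdeg k.2)%N by rewrite [in LHS]mE mdegD.
rewrite -m'E deg_m' -[LHS]add0n => /addIn/esym/eqP; rewrite mdeg_eq0 => /eqP k1E.
by case/eqP: neq_m'; rewrite mE k1E add0m.
Qed.

(** Reducing a homogeneous [f] amounts to dropping its monomials outside the
    family [b]; the coefficients at the [b i], which vanish on the ideal, then
    give independence. *)
Lemma has_dim_quot_monomials (d k : nat) (b : 'I_k -> 'X_{1..n}) :
    injective b -> (forall i, mdeg (b i) = d) ->
    (forall m, mdeg m = d -> m \notin codom b -> 'X_[m] \in ideal_gen G) ->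
    (forall i g, g \in ideal_gen G -> g@_(b i) = 0) ->
  has_dim (quot_graded_piece G d) k.
Proof.
move=> b_inj deg_b idealX coef_ideal.
have lin (c : 'I_k -> F) :
    \sum_i c i *: quot_pi G 'X_[b i] = quot_pi G (\sum_i c i *: 'X_[b i]).
  rewrite [RHS]/quot_pi raddf_sum; apply: eq_bigr => i _.
  exact: quot_piZ.
have coefE (c : 'I_k -> F) i : (\sum_j c j *: 'X_[b j])@_(b i) = c i.
  rewrite raddf_sum (bigD1 i) //= mcoeffZ mcoeffX eqxx mulr1 big1 ?addr0 //.
  by move=> j neq_ji; rewrite mcoeffZ mcoeffX (inj_eq b_inj) (negPf neq_ji) mulr0.
exists (fun i => quot_pi G 'X_[b i]); split=> [i|_ [f hom_f ->]|c].
- by exists 'X_[b i] => //; rewrite dhomogX /= deg_b.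
- exists (fun i => f@_(b i)); rewrite lin; apply/quot_piE.
  set h := f - _.
  have hom_h : h \is d.-homog.
    rewrite rpredB // rpred_sum // => i _; rewrite rpredZ //.
    by rewrite dhomogX /= deg_b.
  rewrite (mpolyE h) big_seq rpred_sum // => m m_h.
  rewrite -mul_mpolyC; apply: ideal_genM; apply: idealX.
    by move/dhomogP: hom_h; apply.
  apply/negP => /codomP[i mE]; move: m_h; rewrite mcoeff_msupp mE mcoeffB coefE.
  by rewrite subrr eqxx.
- rewrite lin => sum0 i; rewrite -(coefE c i); apply: coef_ideal.
  rewrite -[X in X \in _]subr0; apply/quot_piE.
  by rewrite sum0 [RHS]/quot_pi raddf0.
Qed.

End MonomialIdeal.

(** * Least monomials of a multidegree and leading terms *)

Section StandardMonomials.
Set Implicit Arguments.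
Unset Strict Implicit.
Variables (F : fieldType) (p q l : nat) (le_var : rel 'I_(nvars p q l)).
Hypothesis le_anti : antisymmetric le_var.
Hypothesis le_trans : transitive le_var.
Hypothesis le_total : total le_var.
Local Notation monom := 'X_{1..nvars p q l}.
Implicit Types m : monom.

Lemma lex_ltP m m' :
  reflect (exists2 v, m v < m' v & forall w, le_var v w -> w != v -> m w = m' w)
          (lex_lt le_var m m').
Proof.
apply: (iffP existsP) => [[v /andP[lt_v /forallP above]]|[v lt_v above]]; exists v => //.
  by move=> w le_vw neq_wv; apply/eqP; have:= above w; rewrite le_vw neq_wv.
by rewrite lt_v; apply/forallP => w; apply/implyP => /andP[? ?]; apply/eqP/above.
Qed.

Lemma lex_lt_irr : irreflexive (lex_lt le_var).
Proof. by move=> m; apply/lex_ltP => -[v]; rewrite ltnn. Qed.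

(** Of the two deciding variables the larger one decides the composite. *)
Lemma lex_lt_trans : transitive (lex_lt le_var).
Proof.
move=> m2 m1 m3 /lex_ltP[v lt_v above_v] /lex_ltP[w lt_w above_w]; apply/lex_ltP.
have neq_of_le x y z : le_var x y -> y != x -> le_var y z -> z != x.
  move=> le_xy neq_yx le_yz; apply: contra_neq neq_yx => zx.
  by apply: le_anti; rewrite le_xy -{1}zx le_yz.
have [vw|neq_wv] := eqVneq w v.
  exists v; first by apply: ltn_trans lt_v _; rewrite -vw.
  by move=> u le_vu neq_uv; rewrite above_v // above_w // vw.
case/orP: (le_total v w) => [le_vw|le_wv].
  exists w => [|u le_wu neq_uw]; first by rewrite above_v.
  rewrite above_v ?above_w //; first exact: le_trans le_wu.
  exact: neq_of_le le_wu.
rewrite eq_sym in neq_wv.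
exists v => [|u le_vu neq_uv]; first by rewrite -above_w.
rewrite above_v ?above_w //; first exact: le_trans le_vu.
exact: neq_of_le le_vu.
Qed.

Lemma lex_lt_total m m' :
  m != m' -> lex_lt le_var m m' || lex_lt le_var m' m.
Proof.
move=> neq_mm'.
have [v0 neq_v0] : exists v, m v != m' v.
  apply/existsP; apply: contraR neq_mm' => /existsPn eq_mm'.
  by apply/eqP/mnmP => v; apply/eqP; have:= eq_mm' v; rewrite negbK.
(* The variable that decides is the largest one where the exponents differ. *)
pose gt_var : rel 'I_(nvars p q l) := fun v w => le_var w v && (v != w).
have gt_irr : irreflexive gt_var by move=> v; rewrite /gt_var eqxx andbF.
have gt_trans : transitive gt_var.
  move=> v u w /andP[le_vu neq_uv] /andP[le_wv neq_vw].
  rewrite /gt_var (le_trans le_wv le_vu); apply: contra_neq neq_uv => uw.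
  by apply: le_anti; rewrite le_vu uw le_wv.
have [v neq_v max_v] :=
  exists_minimal (P := [pred v | m v != m' v]) gt_irr gt_trans neq_v0.
have above w : le_var v w -> w != v -> m w = m' w.
  move=> le_vw neq_wv; apply/eqP; apply/contraT => neq_w.
  by have:= max_v w neq_w; rewrite /gt_var le_vw neq_wv.
move: neq_v => /=; rewrite neq_ltn => /orP[lt_v|lt_v]; apply/orP.
  by left; apply/lex_ltP; exists v.
by right; apply/lex_ltP; exists v => // w ? ?; rewrite above.
Qed.

Lemma mon_lt_multideg m m' :
  multideg m = multideg m' -> mon_lt le_var m m' = lex_lt le_var m m'.
Proof. by rewrite /mon_lt => -[-> -> ->]; rewrite !eqxx !ltnn. Qed.

(** By [lex_lt_total] this says that [m] is the [lex_lt]-least monomial of its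
    multidegree. *)
Definition standard m : Prop :=
  forall m', multideg m' = multideg m -> ~~ lex_lt le_var m' m.

Lemma exists_standard m :
  exists2 m', standard m' & multideg m' = multideg m.
Proof.
(* The competitors of [m] share its degree, so they lie in the finite type of
   monomials of degree at most [mdeg m]. *)
pose T := 'X_{1..(nvars p q l) < (mdeg m).+1}.
pose r : rel T := fun x y => lex_lt le_var (bmnm x) (bmnm y).
have r_irr : irreflexive r by move=> x; apply: lex_lt_irr.
have r_trans : transitive r by move=> y x z; apply: lex_lt_trans.
have deg_m m' : multideg m' = multideg m -> mdeg m' < (mdeg m).+1 by case=> ->.
pose P := [pred x : T | multideg (bmnm x) == multideg m].
have P0 : P (BMultinom (deg_m m erefl)) by rewrite /= eqxx.
have [x /eqP Px min_x] := exists_minimal r_irr r_trans P0.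
exists (bmnm x) => // m'; rewrite Px => eq_m'.
by apply: (min_x (BMultinom (deg_m m' eq_m'))); rewrite /= eq_m'.
Qed.

Local Open Scope ring_scope.

Lemma msupp_binomial m m' : m != m' ->
  perm_eq (msupp ('X_[m] - 'X_[m'] : {mpoly F[nvars p q l]})) [:: m; m'].
Proof.
move=> neq_mm'; apply: uniq_perm; rewrite ?msupp_uniq /= ?inE ?neq_mm' // => m1.
rewrite mcoeff_msupp mcoeffB !mcoeffX !inE !(eq_sym m1).
have [mE|_] := eqVneq m m1; last first.
  by case: (m' == m1); rewrite ?sub0r ?oppr_eq0 ?oner_eq0 ?subrr ?eqxx.
by rewrite -mE (eq_sym m') (negPf neq_mm') subr0 oner_eq0.
Qed.

(** The other monomial of the binomial is smaller, which forbids standardness. *)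
Lemma in_G1_inv (t : {mpoly F[nvars p q l]}) : in_G1 le_var t ->
  exists c m, [/\ t = c *: 'X_[m], mdeg m = 2%N & ~ standard m].
Proof.
move=> [_ [[m [m' [deg_m deg_m' eq_mm' ->]]] f_neq0 [m1 [m1f lead_m1 ->]]]].
have neq_mm' : m != m' by apply: contra_neq f_neq0 => ->; rewrite subrr.
rewrite (perm_mem (msupp_binomial neq_mm')) !inE in m1f.
exists (('X_[m] - 'X_[m'])@_m1), m1.
case/orP: m1f lead_m1 => /eqP-> lead; split=> // std.
  have := lead m'; rewrite (perm_mem (msupp_binomial neq_mm')) !inE eqxx orbT.
  rewrite eq_sym => /(_ isT neq_mm'); rewrite mon_lt_multideg // => lt_m'm.
  by have:= std m' (esym eq_mm'); rewrite lt_m'm.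
have := lead m; rewrite (perm_mem (msupp_binomial neq_mm')) !inE eqxx.
move=> /(_ isT neq_mm'); rewrite mon_lt_multideg // => lt_mm'.
by have:= std m eq_mm'; rewrite lt_mm'.
Qed.

(** The least monomial of the multidegree serves as the second term of a
    binomial led by any other monomial. *)
Lemma in_G1X m m' : mdeg m = 2%N -> multideg m' = multideg m -> standard m' ->
  m != m' -> in_G1 (F := F) le_var 'X_[m].
Proof.
move=> deg_m eq_m'm std_m' neq_mm'.
have deg_m' : mdeg m' = 2%N by case: eq_m'm => ->.
have suppE := perm_mem (msupp_binomial neq_mm').
have coef1 : ('X_[m] - 'X_[m'] : {mpoly F[nvars p q l]})@_m = 1.
  by rewrite mcoeffB !mcoeffX eqxx eq_sym (negPf neq_mm') subr0.
exists ('X_[m] - 'X_[m']); split; first by exists m, m'.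
  by apply/eqP => f0; have:= oner_eq0 F; rewrite -coef1 f0 mcoeff0 eqxx.
exists m; split; rewrite ?coef1 ?scale1r ?suppE ?inE ?eqxx //.
move=> m1; rewrite suppE !inE => /orP[->//|/eqP-> _].
rewrite mon_lt_multideg //; have := lex_lt_total neq_mm'.
by rewrite (negPf (std_m' _ (esym eq_m'm))).
Qed.

End StandardMonomials.

(** * Multidegrees of degree 2 monomials *)

Section Multidegrees.
Set Implicit Arguments.
Unset Strict Implicit.
Variables p q l : nat.
Implicit Type m : 'X_{1..nvars p q l}.

Lemma mdeg_eq2 (n : nat) (m : 'X_{1..n}) :
  mdeg m = 2 -> exists i j, m = (U_(i) + U_(j))%MM.
Proof.
move=> deg_m.
have [i m_i] : exists i, m i != 0.
  apply/existsP; apply: contraT => /existsPn m0.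
  have : m = 0%MM.
    by apply/mnmP => i; rewrite mnm0E; apply/eqP; have:= m0 i; rewrite negbK.
  by move=> mE; rewrite mE mdeg0 in deg_m.
have mE : m = (U_(i) + (m - U_(i)))%MM.
  rewrite addmC submK //; apply/mnm_lepP => k; rewrite mnm1E.
  by case: eqP => // <-; rewrite lt0n.
have : mdeg (m - U_(i))%MM == 1.
  by move/eqP: deg_m; rewrite {1}mE mdegD mdeg1.
by rewrite mdeg_eq1 => /existsP[j /eqP jE]; exists i, j; rewrite -jE.
Qed.

Lemma sum_mnm2 (n : nat) (w : 'I_n -> nat) (i j : 'I_n) :
  \sum_k (U_(i) + U_(j))%MM k * w k = w i + w j.
Proof.
have sum_mnm1 h : \sum_k U_(h)%MM k * w k = w h.
  rewrite (bigD1 h) //= mnm1E eqxx mul1n big1 ?addn0 // => k neq_kh.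
  by rewrite mnm1E eq_sym (negPf neq_kh).
rewrite -[in RHS](sum_mnm1 i) -[in RHS](sum_mnm1 j) -big_split; apply: eq_bigr => k _.
by rewrite mnmDE mulnDl.
Qed.

Lemma pt_mem (i : 'I_(nvars p q l)) : pt i \in A p q l.
Proof. exact: mem_nth. Qed.

Lemma mem_minkowski_A m : mdeg m = 2 ->
  (sumN m, summu m) \in minkowski (A p q l) (A p q l).
Proof.
move=> /mdeg_eq2[i [j ->]]; rewrite /sumN /summu !sum_mnm2.
by apply/imfset2P; exists (pt i); rewrite ?pt_mem //; exists (pt j); rewrite ?pt_mem.
Qed.

Lemma minkowski_A_exists s : s \in minkowski (A p q l) (A p q l) ->
  exists m, multideg m = (2, s.1, s.2).
Proof.
have pt_surj x : x \in A p q l -> exists i : 'I_(nvars p q l), x = pt i.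
  move=> Ax; have ltx := Ax; rewrite -index_mem in ltx.
  by exists (Ordinal ltx); rewrite /pt nth_index.
move=> /imfset2P[x /pt_surj[i ->]] [y /pt_surj[j ->]] ->.
exists (U_(i) + U_(j))%MM.
by rewrite /multideg mdegD !mdeg1 /sumN /summu !sum_mnm2.
Qed.

End Multidegrees.

(** * The dimension of the degree 2 piece *)

Theorem proposition11 (F : fieldType) (p q l : nat)
    (le_var : rel 'I_(nvars p q l)) :
  prime p -> (1 <= q)%N -> (1 <= l <= p - 1)%N ->
  reflexive le_var -> antisymmetric le_var -> transitive le_var ->
  total le_var ->
  has_dim (quot_graded_piece (in_G1 (F := F) le_var) 2)
          #|` minkowski (A p q l) (A p q l)|%fset.
Proof.
move=> _ _ _ _ le_anti le_trans le_total.
set AA := minkowski (A p q l) (A p q l).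
pose s (i : 'I_#|` AA|%fset) := nth (0, 0) AA i.
have : forall i, exists m, standard le_var m /\ multideg m = (2, (s i).1, (s i).2).
  move=> i; have /minkowski_A_exists[m mE] : s i \in AA by apply: mem_nth.
  have [m' std_m' m'E] := exists_standard le_anti le_trans le_total m.
  by exists m'; split; rewrite ?m'E.
move=> /fin_all_exists[b b_std].
have deg_b i : mdeg (b i) = 2 by have [_ []] := b_std i.
apply: (has_dim_quot_monomials _ deg_b).
- move=> i j eq_b; have [_ bi] := b_std i; have [_ bj] := b_std j.
  have eq_s : s i = s j.
    by move: bi; rewrite eq_b bj => -[]; case: (s i) (s j) => ? ? [? ?] /= -> ->.
  by apply/val_inj/eqP; rewrite /= -(nth_uniq (0, 0) _ _ (fset_uniq AA)) //; apply/eqP.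
(* A monomial [m] outside the family is distinct from the standard monomial of
   its own multidegree, hence is a leading term. *)
- move=> m deg_m m_notin.
  have AAm := mem_minkowski_A deg_m.
  have lt_i := AAm; rewrite -index_mem in lt_i.
  pose i : 'I_#|` AA|%fset := Ordinal lt_i.
  have [std_i] := b_std i.
  rewrite /s nth_index // => bE.
  have inX : in_G1 (F := F) le_var 'X_[m].
    apply: (in_G1X F le_anti le_trans deg_m _ std_i).
      by rewrite bE /multideg deg_m.
    by apply: contraNneq m_notin => ->; apply: codom_f.
  apply/asboolP; exists [:: (1%R, 'X_[m])]; rewrite big_seq1 mul1r.
  by split=> // ag; rewrite inE => /eqP->.
- move=> i; apply: mcoeff_ideal_gen_eq0 => t /in_G1_inv[c [m [-> deg_m nstd_m]]].
  exists c, m; rewrite deg_m deg_b; split=> //.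
  by apply: contra_notN nstd_m => /eqP->; have [] := b_std i.
Qed.
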